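(* Let $G$ be a connected graph. If $p\geq 2$ is a real number, then $$A_p(G)\leq \sqrt{F-2M_2},$$ with equality if and only if $d(u)-d(v)\neq 0$ for a unique edge $uv$ of $G$ and $d(u)-d(v)=0$ for all the other edges $uv$ of $G$.
   Context: Graphs are finite, simple and undirected; $d(v)$ is the degree of vertex $v$ in $G$. For a positive real number $p$, the general Albertson irregularity index of a connected graph $G$ is $A_p(G)=\left(\sum_{uv\in E(G)}|d(u)-d(v)|^p\right)^{1/p}$. $F=\sum_{v\in V(G)}d(v)^3$ is the forgotten topological index of $G$ and $M_2=\sum_{uv\in E(G)}d(u)d(v)$ is the second Zagreb index of $G$, so that $F-2M_2=\sum_{uv\in E(G)}(d(u)-d(v))^2$.
   Formalization: Equality also holds whenever p = 2 (e.g. the path on three vertices) and for every regular graph (both sides are 0), so these two cases are added to the equality condition; for p > 2 and non-regular G it is the stated equivalence. *)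

(* Defs.v *)
From mathcomp Require Import all_boot all_order all_algebra.
From mathcomp Require Import reals exp.

Set Implicit Arguments.
Unset Strict Implicit.
Unset Printing Implicit Defensive.

Import Order.TTheory GRing.Theory Num.Theory.

Local Open Scope ring_scope.

(* A finite simple graph is a symmetric irreflexive relation e on a finType. *)

Definition connected_graph (T : finType) (e : rel T) : Prop :=
  (0 < #|T|)%N /\ forall u v : T, connect e u v.

Definition deg (T : finType) (e : rel T) (v : T) : nat := #|[set w | e v w]|.

(* Every edge uv is represented by exactly one of (u, v) and (v, u), chosen by
   enumeration rank, so that sums over edge_pairs e are sums over E(G) as soon
   as the summand is symmetric in u and v. *)
Definition edge_pairs (T : finType) (e : rel T) : {set T * T} :=
  [set uv | e uv.1 uv.2 && (enum_rank uv.1 < enum_rank uv.2)%N].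

Definition albertson (R : realType) (T : finType) (e : rel T) (p : R) : R :=
  (\sum_(uv in edge_pairs e)
     `|(deg e uv.1)%:R - (deg e uv.2)%:R| `^ p) `^ p^-1.

Definition forgotten (T : finType) (e : rel T) : nat :=
  (\sum_(v : T) deg e v ^ 3)%N.

Definition zagreb2 (T : finType) (e : rel T) : nat :=
  (\sum_(uv in edge_pairs e) deg e uv.1 * deg e uv.2)%N.

(* For regular graphs both sides of the inequality vanish although no edge has
   ends of different degrees, so the equality case must list them separately;
   likewise p = 2, where F - 2 M_2 equals the square of A_2. *)
Definition regular_graph (T : finType) (e : rel T) : Prop :=
  forall u v : T, deg e u = deg e v.

Definition unique_irregular_edge (T : finType) (e : rel T) : Prop :=
  exists u v : T,
    [/\ e u v, deg e u <> deg e v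
      & forall x y : T, e x y -> [set x; y] <> [set u; v] -> deg e x = deg e y].

(* Main.v *)
(* Write a_uv = |d(u) - d(v)| and let s be the l^2 norm of a over the edges.
   Each a_uv is at most s, so a_uv^p <= a_uv^2 s^(p-2), and summing gives
   sum a_uv^p <= s^p.  For p > 2 equality forces every a_uv to be 0 or s; two
   nonzero values would give 2 s^2 <= s^2, so at most one edge has ends of
   different degrees, and if there is none, connectedness makes G regular. *)
Require Import Defs.
From mathcomp Require Import all_boot all_order all_algebra.
From mathcomp Require Import reals exp.

Import Order.TTheory GRing.Theory Num.Theory.

Local Open Scope ring_scope.

Lemma powR_le_sqrM {R : realType} {a s p : R} :
  2 <= p -> 0 <= a <= s ->
  a `^ p <= a ^+ 2 * s `^ (p - 2) ?= iff [|| p == 2, a == 0 | a == s].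
Proof.
move=> p2 /andP[a0 les].
have p0 : p != 0 by rewrite gt_eqF // (lt_le_trans _ p2) // ltr0n.
(* [powRD] admits a zero base as long as the total exponent, here [p], is nonzero. *)
have -> : a `^ p = a ^+ 2 * a `^ (p - 2).
  by rewrite -powR_mulrn // -powRD addrC subrK // (negbTE p0).
have [->|aN0] := eqVneq a 0.
  by rewrite expr0n !mul0r /= orbT; apply/leif_refl.
have [->|aNs] := eqVneq a s; first by rewrite /= orbT; apply/leif_refl.
have [->|pN2] := eqVneq p 2.
  by rewrite subrr !powRr0 /=; apply/leif_refl.
have lt2 : a `^ (p - 2) < s `^ (p - 2).
  apply: gt0_ltr_powR; rewrite ?nnegrE ?(le_trans a0 les) //.
    by rewrite subr_gt0 lt_def pN2.
  by rewrite lt_def eq_sym aNs.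
have lt : a ^+ 2 * a `^ (p - 2) < a ^+ 2 * s `^ (p - 2).
  by rewrite ltr_pM2l // exprn_gt0 // lt_def aN0.
by split; [exact: ltW | exact: lt_eqF].
Qed.

(** The part of the argument free of graphs. Asking for at most one nonzero term, rather than
    exactly one, also covers the zero family, which regular graphs produce. *)
Lemma lp_norm_le_l2_norm {R : realType} {I : finType} (A : {set I})
    (a : I -> R) (p : R) (a_ge0 : forall i, 0 <= a i) (p_ge2 : 2 <= p)
    (s := Num.sqrt (\sum_(i in A) a i ^+ 2)) :
  (\sum_(i in A) a i `^ p) `^ p^-1 <= s /\
  ((\sum_(i in A) a i `^ p) `^ p^-1 = s <->
   p = 2 \/ {in A &, forall i j, a i != 0 -> a j != 0 -> i = j}).
Proof.
have p_gt0 : 0 < p by rewrite (lt_le_trans _ p_ge2) // ltr0n.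
have pN0 : p != 0 by rewrite gt_eqF.
have s_ge0 : 0 <= s by exact: sqrtr_ge0.
have s2 : s ^+ 2 = \sum_(i in A) a i ^+ 2.
  by rewrite sqr_sqrtr // sumr_ge0 // => i _; rewrite sqr_ge0.
have le_s i : i \in A -> a i <= s.
  move=> iA; rewrite -(@ler_pXn2r _ 2) ?nnegrE // s2 (bigD1 i) //=.
  by rewrite lerDl sumr_ge0 // => j _; rewrite sqr_ge0.
have := leif_sum (P := mem A) (fun i iA =>
  powR_le_sqrM p_ge2 (introT andP (conj (a_ge0 i) (le_s i iA)))).
(* The summed bound is [s ^+ 2 * s]^ (p - 2)[, that is,]s [^ p]. *)
rewrite -mulr_suml -s2 -powR_mulrn // -powRD; last first.
  by rewrite addrC subrK (negbTE pN0).
rewrite (addrC 2) subrK.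
set S := \sum_(i in A) a i `^ p => -[leS eqS].
have S_ge0 : 0 <= S by rewrite sumr_ge0 // => i _; rewrite powR_ge0.
have powRV (x : R) : 0 <= x -> (x `^ p) `^ p^-1 = x.
  by move=> x0; rewrite -powRrM mulfV // powRr1.
split.
  rewrite -[leRHS]powRV //.
  by apply: ge0_ler_powR; rewrite ?nnegrE ?invr_ge0 ?powR_ge0 ?(ltW p_gt0).
have -> : (S `^ p^-1 = s) <-> S = s `^ p.
  split=> [<-|->]; last exact: powRV.
  by rewrite -powRrM mulVf // powRr1.
apply: (iff_trans (rwP eqP)); rewrite eqS; split.
  move=> /forall_inP eq_as; have [->|pN2] := eqVneq p 2; [by left | right].
  move=> i j iA jA aiN0 ajN0; apply/eqP; apply: contraT => iNj.
  have eq_s k : k \in A -> a k != 0 -> a k = s.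
    move=> kA akN0; move: (eq_as k kA).
    by rewrite (negbTE pN2) (negbTE akN0) => /eqP.
  have : a i ^+ 2 + a j ^+ 2 <= s ^+ 2.
    rewrite s2 (bigD1 i) //= lerD2l (bigD1 j) /=; last by rewrite jA eq_sym.
    by rewrite lerDl sumr_ge0 // => k _; rewrite sqr_ge0.
  rewrite -(eq_s i iA aiN0) gerDl => /(conj (sqr_ge0 (a j)))/andP/le_anti.
  by move/eqP; rewrite eq_sym sqrf_eq0 (negbTE ajN0).
move=> [->|uniqA]; apply/forall_inP => i iA; first by rewrite eqxx.
have [//|aiN0] := eqVneq (a i) 0; first by rewrite orbT.
(* The sum defining [s ^+ 2] collapses to its only nonzero term. *)
suff -> : a i = s by rewrite eqxx !orbT.
apply/eqP; rewrite -(eqrXn2 (n := 2)) // s2 (bigD1 i) //= big1 ?addr0 //.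
move=> j /andP[jA jNi]; apply/eqP; rewrite sqrf_eq0.
by apply: contraNT jNi => ajN0; rewrite (uniqA j i).
Qed.

Section Graph.
Context {T : finType} {e : rel T}.
Hypotheses (e_sym : symmetric e) (e_irr : irreflexive e).

(** Each edge carries two arcs, one increasing in rank and one decreasing; swapping coordinates maps
    the second kind onto the first. Irreflexivity excludes equal ranks. *)
Lemma sum_arcs {V : nmodType} (f : T -> T -> V) :
  \sum_u \sum_(v | e u v) f u v =
  \sum_(uv in edge_pairs e) (f uv.1 uv.2 + f uv.2 uv.1).
Proof.
rewrite pair_big_dep big_split /=.
rewrite (bigID (fun uv => enum_rank uv.1 < enum_rank uv.2)%N) /=.
congr (_ + _); first by apply: eq_bigl => uv; rewrite inE.
rewrite (reindex_inj (can_inj (@swap_pairK T T))) /=.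
apply: eq_bigl => -[u v] /=.
rewrite inE /= e_sym -leqNgt leq_eqVlt; case euv: (e u v) => //=.
by case: eqP => // /val_inj/enum_rank_inj uv; rewrite uv e_irr in euv.
Qed.

(** Giving each arc leaving [u] the weight [deg e u ^ 2] makes the total [F]; regrouped by edges, it
    completes the squares with [-2 M_2]. *)
Lemma forgotten_sub_zagreb2 (R : realType) :
  (forgotten e)%:R - 2 * (zagreb2 e)%:R =
  \sum_(uv in edge_pairs e) `|(deg e uv.1)%:R - (deg e uv.2)%:R| ^+ 2 :> R.
Proof.
have -> : forgotten e = (\sum_(uv in edge_pairs e)
    (deg e uv.1 ^ 2 + deg e uv.2 ^ 2))%N.
  rewrite -(sum_arcs (fun u _ => deg e u ^ 2)%N).
  apply: eq_bigr => u _; rewrite sum_nat_const expnS; congr (_ * _)%N.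
  by rewrite /deg cardsE.
rewrite /zagreb2 !natr_sum mulr_sumr -sumrB; apply: eq_bigr => uv _.
rewrite real_normK ?num_real // sqrrB natrD !natrX natrM.
by rewrite mulr_natl addrAC.
Qed.

(** Needed because [unique_irregular_edge] compares edges as unordered sets, while the sums run over
    ordered pairs. *)
Lemma edge_pairs_inj :
  {in edge_pairs e &, injective (fun uv : T * T => [set uv.1; uv.2])}.
Proof.
move=> [u v] [x y]; rewrite !inE /= => /andP[_ uv] /andP[_ xy] /setP eq_s.
have := eq_s u; have := eq_s v; rewrite !inE !eqxx orbT /= => /esym + /esym.
(* Matchings with [u = v] contradict the strict rank order; the swapped one, left for the last line,
   reverses it. *)
move=> /orP[]/eqP ? /orP[]/eqP ?; subst; rewrite ?ltnn // in uv *.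
by rewrite ltnNge (ltnW xy) in uv.
Qed.

Lemma edge_pairsP {u v : T} :
  e u v -> (u, v) \in edge_pairs e \/ (v, u) \in edge_pairs e.
Proof.
move=> euv; rewrite !inE /= euv (e_sym v) euv /=.
case: ltngtP => [_|_|/val_inj/enum_rank_inj uv]; [by left | by right |].
by rewrite uv e_irr in euv.
Qed.

(** Induction along a path; connectedness enters the proof only here. *)
Lemma regular_connected (e_conn : connected_graph e) :
  (forall u v, e u v -> deg e u = deg e v) -> regular_graph e.
Proof.
move=> deg_e u v; have /connectP[c + ->] := e_conn.2 u v.
elim: c u => //= w c IHc u /andP[euw /IHc <-]; exact: deg_e.
Qed.

(** Translates the equality case of the norm inequality into graph terms: one irregular edge, or
    none and hence a regular graph. *)
Lemma at_most_one_irregular_edge (e_conn : connected_graph e) :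
  {in edge_pairs e &, forall a b : T * T,
    deg e a.1 != deg e a.2 -> deg e b.1 != deg e b.2 -> a = b} <->
  unique_irregular_edge e \/ regular_graph e.
Proof.
split=> [uniq_e|[[u [v [euv duv irr_uv]]]|reg] a b aE bE da db]; last first.
- by rewrite (reg a.1 a.2) eqxx in da.
- have set_uv (c : T * T) : c \in edge_pairs e -> deg e c.1 != deg e c.2 ->
      [set c.1; c.2] = [set u; v].
    rewrite inE => /andP[ec _] dc; apply/eqP; apply: contraNT dc => /eqP.
    by move/(irr_uv _ _ ec)/eqP.
  by apply: edge_pairs_inj; rewrite // !set_uv.
have [[u v] /andP[uvE /= duv]|reg] :=
  pickP (fun a : T * T => (a \in edge_pairs e) && (deg e a.1 != deg e a.2)).
  left; exists u, v; split; first by move: uvE; rewrite inE => /andP[].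
    exact/eqP.
  move=> x y exy xyNuv; apply/eqP; apply: contra_notT xyNuv => dxy.
  have [xyE|yxE] := edge_pairsP exy.
    by have [-> ->] := uniq_e _ _ xyE uvE dxy duv.
  (* Here the edge is represented by [(y, x)], so both the set and the inequality are flipped
     first. *)
  rewrite setUC; rewrite eq_sym in dxy.
  by have [-> ->] := uniq_e _ _ yxE uvE dxy duv.
right; apply: regular_connected => // x y exy; apply/eqP.
have [xyE|yxE] := edge_pairsP exy.
  by have := reg (x, y); rewrite /= xyE /= => /negbFE.
by have := reg (y, x); rewrite /= yxE /= eq_sym => /negbFE.
Qed.

End Graph.

Theorem theorem3p6 (R : realType) (T : finType) (e : rel T) (p : R)
    (e_sym : symmetric e) (e_irr : irreflexive e)
    (e_conn : connected_graph e) (p_ge2 : 2 <= p) :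
  albertson e p <= Num.sqrt ((forgotten e)%:R - 2 * (zagreb2 e)%:R) /\
  (albertson e p = Num.sqrt ((forgotten e)%:R - 2 * (zagreb2 e)%:R) <->
   [\/ unique_irregular_edge e, p = 2 | regular_graph e]).
Proof.
rewrite forgotten_sub_zagreb2 // /albertson.
have [le_A eq_A] := lp_norm_le_l2_norm (edge_pairs e)
  (fun uv : T * T => `|(deg e uv.1)%:R - (deg e uv.2)%:R| : R)
  p (fun _ => normr_ge0 _) p_ge2.
have irrE (a : T * T) :
    (`|(deg e a.1)%:R - (deg e a.2)%:R| != 0 :> R) = (deg e a.1 != deg e a.2).
  by rewrite normr_eq0 subr_eq0 eqr_nat.
have [uniq1 uniq2] := at_most_one_irregular_edge e_sym e_irr e_conn.
split=> //; rewrite eq_A; split.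
  move=> [->|uniq_e]; first by constructor 2.
  have [|?|?] := uniq1; [|by constructor 1|by constructor 3].
  by move=> a b aE bE da db; apply: uniq_e; rewrite ?irrE.
move=> [irr|->|reg]; [right|by left|right];
  move=> a b aE bE; rewrite !irrE; apply: uniq2 => //; [by left|by right].
Qed.
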